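(* If every metric space satisfying $\mathsf S_1(\Omega,\Omega^{gp})$ is countable, then every strong measure zero metric space is countable; consequently, the two assertions ''every metric space satisfying $\mathsf S_1(\Omega,\Omega^{gp})$ is countable'' and ''every strong measure zero metric space is countable'' are equivalent.
   Context: A metric space $X$ has strong measure zero if for each sequence $\{\epsilon_n\}_{n\in\mathbb N}$ of positive reals there is a cover $\{I_n\}_{n\in\mathbb N}$ of $X$ such that $\operatorname{diam}(I_n)<\epsilon_n$ for all $n$. For a topological space $X$: an open cover $\mathcal U$ of $X$ is an $\omega$-cover if $X\notin\mathcal U$ and for each finite $F\subseteq X$ there is $U\in\mathcal U$ with $F\subseteq U$. $\Omega$ denotes the collection of all countable open $\omega$-covers of $X$. $\Omega^{gp}$ denotes the collection of open $\omega$-covers $\mathcal U$ of $X$ for which there exists a partition $\mathcal P$ of $\mathcal U$ into finite sets such that for each finite $F\subseteq X$ and all but finitely many $\mathcal F\in\mathcal P$, there exists $U\in\mathcal F$ with $F\subseteq U$. $X$ satisfies $\mathsf S_1(\Omega,\Omega^{gp})$ if for each sequence $\{\mathcal U_n\}_{n\in\mathbb N}$ of members of $\Omega$ there exist $U_n\in\mathcal U_n$, $n\in\mathbb N$, such that $\{U_n: n\in\mathbb N\}\in\Omega^{gp}$. *)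

(* Defs.v *)
From mathcomp Require Import all_boot all_order all_algebra.
From mathcomp Require Import boolp classical_sets functions cardinality.
From mathcomp Require Import reals constructive_ereal ereal topology.
From mathcomp Require Import metric_structure.

Set Implicit Arguments.
Unset Strict Implicit.
Unset Printing Implicit Defensive.

Import Order.TTheory GRing.Theory Num.Theory.

Local Open Scope classical_set_scope.
Local Open Scope ring_scope.
Local Open Scope ereal_scope.

(* The supremum is taken in [0, +oo]: the maximum with 0 only matters for the
   empty set, whose [ereal_sup] is -oo and whose diameter is 0. *)
Definition diam (R : realType) (X : metricType R) (A : set X) : \bar R :=
  maxe 0 (ereal_sup [set d | exists x y, [/\ A x, A y & d = (mdist x y)%:E]]).

Definition strong_measure_zero (R : realType) (X : metricType R) : Prop :=
  forall eps : nat -> R, (forall n, (0 < eps n)%R) ->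
  exists I : nat -> set X,
    cover [set: nat] I = [set: X] /\ forall n, diam (I n) < (eps n)%:E.

Definition open_omega_cover (X : topologicalType) (U : set (set X)) : Prop :=
  [/\ forall A, U A -> open A,
      ~ U [set: X] &
      forall F : set X, finite_set F -> exists2 A, U A & F `<=` A].

Definition Omega (X : topologicalType) : set (set (set X)) :=
  [set U | open_omega_cover U /\ countable U].

Definition Omega_gp (X : topologicalType) : set (set (set X)) :=
  [set U | open_omega_cover U /\
    exists P : set (set (set X)),
      [/\ partition P id U,
          forall B, P B -> finite_set B &
          forall F : set X, finite_set F ->
            finite_set [set B | P B /\ ~ exists2 A, B A & F `<=` A]]].

Definition S1 (T : Type) (A B : set (set T)) : Prop :=
  forall U : nat -> set T, (forall n, A (U n)) ->
  exists V : nat -> T, (forall n, U n (V n)) /\ B (range V).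

Definition S1_Omega_Omega_gp (X : topologicalType) : Prop :=
  S1 (@Omega X) (@Omega_gp X).

(* Main.v *)
Require Import Defs.
From HB Require Import structures.
From mathcomp Require Import all_boot all_order all_algebra.
From mathcomp Require Import boolp classical_sets functions cardinality wochoice.
From mathcomp Require Import reals constructive_ereal ereal topology.
From mathcomp Require Import metric_structure.
From mathcomp Require Import zify.

(** An uncountable space of one kind yields an uncountable space of the other
    kind, though usually not on the same points.

    From strong measure zero to S1(Omega, Omega^gp).  An uncountable X contains
    an injective image of a well-order O of type omega_1 ([uncountable_omega1]).
    Either every family of functions nat -> nat indexed by O is bounded modulo
    finite sets, or some such family is unbounded.

    In the bounded case, the copy of O inside X works.  Strong measure zero
    guesses points with prescribed precision; boundedness turns the fact that each tuple
    is guessed at some stage into one function valid for all tuples, which makes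
    it possible to guess k-tuples by induction on k ([guess_tuples]) and to do
    so within prescribed blocks of stages.  A sufficiently precise guess of the
    points of a finite set determines a member of the omega-cover containing it.

    In the unbounded case, there is a family g_z, z in O, of strictly increasing
    functions that is increasing modulo finite sets and unbounded
    ([dominating_chain]).  Take in the Cantor space the ranges of the g_z
    together with the finite sets.  A member of an omega-cover that contains all
    subsets of {0, ..., n-1} contains every set that omits a certain interval
    [n, m).  Iterating gives consecutive intervals; unboundedness provides a z
    such that all g_w with w >= z are sparse on infinitely many fixed blocks of
    intervals, and by the pigeonhole principle any finitely many of them omit a
    common interval in almost every such block ([selects_tail]).  The countably
    many points below z are dealt with one at a time, with disjoint sets of
    indices, by induction on the number of points to be covered
    ([selects_extend]).

    In both cases the classes of finite sets that can be dealt with are closed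
    under countable unions ([selects_bigcup]), and dealing with all finite sets
    gives a groupable omega-cover ([selects_S1]).

    From S1(Omega, Omega^gp) to strong measure zero.  If X is separable, the
    usual argument with finite unions of small balls applies ([S1_smz]).
    Otherwise X contains an uncountable uniformly separated set, so it contains
    a copy of O every subset of which is closed; the selection property passes
    to any other metric on O ([S1_closed_discrete]), in particular to a
    separable one obtained by embedding O in the Cantor space. *)

Set Implicit Arguments.
Unset Strict Implicit.
Unset Printing Implicit Defensive.

Import Order.TTheory GRing.Theory Num.Theory.

Local Open Scope classical_set_scope.

(** * Pairing of indices and eventual domination *)

(** The lower bound on the code makes a condition on all large codes a
    consequence of the same condition on all large first, or all large second,
    components. *)
Lemma pairing : {f : (nat -> nat -> nat) * (nat -> nat * nat) |
  [/\ forall c i, f.2 (f.1 c i) = (c, i), forall n, f.1 (f.2 n).1 (f.2 n).2 = n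
    & forall c i, maxn c i <= f.1 c i]}.
Proof.
exists (fun c i => (2 ^ c * i.*2.+1).-1,
  fun n => (logn 2 n.+1, (n.+1 %/ 2 ^ logn 2 n.+1)./2)); split=> [c i|n|c i] /=.
- rewrite prednK ?muln_gt0 ?expn_gt0//.
  have -> : logn 2 (2 ^ c * i.*2.+1) = c.
    rewrite lognM ?expn_gt0// pfactorK// lognE/= dvdn2/= odd_double/=.
    by rewrite addn0.
  by rewrite mulKn ?expn_gt0//= uphalf_double.
- have [m cm e] := pfactor_coprime (isT : prime 2) (ltn0Sn n).
  rewrite {2}e mulnK ?expn_gt0//.
  have om : odd m by rewrite coprime2n in cm.
  have -> : m./2.*2.+1 = m by rewrite -[RHS]odd_double_half om.
  by rewrite mulnC -e.
- have : c < 2 ^ c by exact: ltn_expl.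
  rewrite geq_max; nia.
Qed.

Definition pairn := (sval pairing).1.
Definition unpairn := (sval pairing).2.

Lemma pairnK c i : unpairn (pairn c i) = (c, i).
Proof. by rewrite /pairn /unpairn; case: pairing => f []. Qed.

Lemma unpairnK n : pairn (unpairn n).1 (unpairn n).2 = n.
Proof. by rewrite /pairn /unpairn; case: pairing => f []. Qed.

Lemma leq_pairn c i : maxn c i <= pairn c i.
Proof. by rewrite /pairn; case: pairing => f []. Qed.

Lemma leq_pairnl c i : c <= pairn c i.
Proof. exact: leq_trans (leq_maxl _ _) (leq_pairn c i). Qed.

Lemma leq_pairnr c i : i <= pairn c i.
Proof. exact: leq_trans (leq_maxr _ _) (leq_pairn c i). Qed.

Definition eventually_le (f g : nat -> nat) := \forall n \near \oo, f n <= g n.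

Lemma eventually_le_trans g f h : eventually_le f g -> eventually_le g h -> eventually_le f h.
Proof. by apply: filterS2 => n; apply: leq_trans. Qed.

Lemma countable_enum T (A : set T) : countable A ->
  exists e : nat -> option T, forall x, A x -> exists n, e n = Some x.
Proof.
move=> /countable_injP[f finj].
have /choice[e eP] : forall n, exists o : option T,
    (exists2 x, A x & f x = n) -> exists2 x, A x & f x = n /\ o = Some x.
  move=> n; have [[x Ax fx]|h] := pselect (exists2 x, A x & f x = n).
    by exists (Some x) => _; exists x.
  by exists None.
exists e => x Ax; exists (f x).
have [|y Ay [fy ->]] := eP (f x); first by exists x.
by congr Some; apply: finj; rewrite ?inE.
Qed.

Lemma countable_eventually_le T (A : set T) (f : T -> nat -> nat) : countable A ->
  exists h, forall x, A x -> eventually_le (f x) h.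
Proof.
move=> /countable_enum[e eP].
exists (fun n => \max_(i < n.+1) oapp (f^~ n) 0 (e i)) => x /eP[k ek].
exists k => // n /= kn.
rewrite -[f x n]/(oapp (f^~ n) 0 (Some x)) -ek.
by rewrite (leq_bigmax (Ordinal (kn : k < n.+1))).
Qed.

(** * Groupable selections *)

Section Selection.
Variable T : choiceType.
Implicit Types (U : nat -> set (set T)) (F : set (seq T)).

(** The windows [p, g p) replace the blocks of a partition: if almost every
    window contains an index of a set that covers s, then so does almost every
    block of a partition whose blocks contain such windows.  Unlike
    partitions, window functions have a common enlargement: their maximum. *)
Definition captured (V : nat -> set T) (g : nat -> nat) (s : seq T) :=
  \forall p \near \oo, exists2 j, p <= j < g p & forall x, x \in s -> V j x.

Definition selects U F := exists V g,
  (forall n, U n (V n)) /\ (forall s, F s -> captured V g s).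

(** The c-th class uses only the indices with first coordinate c, so the
    selections do not interfere; a window for the union has to contain windows
    for the first p classes only, since each class may ignore finitely many
    windows. *)
Lemma selects_bigcup U (F : nat -> set (seq T)) :
  (forall c, selects (fun i => U (pairn c i)) (F c)) ->
  selects U (\bigcup_c F c).
Proof.
move=> /choice[V /choice[g Vg]].
exists (fun n => V (unpairn n).1 (unpairn n).2).
exists (fun p => \max_(c < p.+1) \max_(i < g c p) (pairn c i).+1).
split=> [n|s [c _ /(Vg c).2]].
  by have [+ _] := Vg (unpairn n).1 => /(_ (unpairn n).2); rewrite unpairnK.
move=> [N _ NP]; exists (maxn N c) => // p /=; rewrite geq_max => /andP[Np cp].
have [i /andP[pi ig] sV] := NP p Np; exists (pairn c i); last first.
  by move=> x /sV; rewrite /= pairnK.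
rewrite (leq_trans pi (leq_pairnr _ _))/=.
apply: leq_trans (leq_bigmax (Ordinal (cp : c < p.+1))) => /=.
exact: leq_trans (leq_bigmax (Ordinal ig)).
Qed.

Lemma selects_sub U F F' : F `<=` F' -> selects U F' -> selects U F.
Proof. by move=> FF' [V [g [UV Vg]]]; exists V, g; split=> // s /FF'/Vg. Qed.

End Selection.

Lemma omega_cover_seq (X : topologicalType) (U : set (set X)) (s : seq X) :
  open_omega_cover U -> exists2 A, U A & forall x, x \in s -> A x.
Proof. by move=> [_ _ /(_ [set` s] (finite_seq s))[A UA sA]]; exists A. Qed.

Lemma not_fullP X (A : set X) : A <> setT -> exists x, ~ A x.
Proof. by move/eqP/setTPn. Qed.

(** Since each set occurs finitely often in V, block i can be taken so long
    that it contains a window all of whose sets occur at no index of the earlier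
    blocks; deleting from the block the sets that occurred before then leaves
    this window intact. *)
Lemma Omega_gp_groups (X : topologicalType) (V : nat -> set X) g :
  (forall n, open (V n)) -> (forall n, V n <> setT) ->
  (forall A, exists N, forall n, V n = A -> n <= N) ->
  (forall s : seq X, captured V g s) -> Omega_gp (range V).
Proof.
move=> oV VT /choice[N NP] Vg.
split.
  split; first by move=> _ [n _ <-].
    by move=> [n _] /VT.
  move=> F /finite_seqP[s ->]; have [p _ /(_ p (leqnn p))] := Vg s.
  by move=> [j _ sV]; exists (V j).
(* From index b m on, no set equals one with index below m, and the block
   [a i, a i.+1) has room for the window [b (a i), g (b (a i))). *)
pose b m := (m + \max_(i < m) N (V i)).+1.
pose a := fix a i := if i is j.+1 then (b (a j) + g (b (a j))).+1 else 0.
have blt i : b (a i) < a i.+1 by rewrite /= ltnS leq_addr.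
have able i : a i < b (a i) by rewrite ltnS leq_addr.
have alt i : a i < a i.+1 by apply: ltn_trans (blt i).
have ale i j : i <= j -> a i <= a j.
  elim: j => [|j IH]; first by rewrite leqn0 => /eqP->.
  by rewrite leq_eqVlt => /orP[/eqP->//|/IH h]; exact: leq_trans (ltnW (alt j)).
have age i : i <= a i by elim: i => // i IH; exact: leq_ltn_trans (alt i).
pose lev i := [set V j | j in [set j | j < a i]].
pose B i := lev i.+1 `\` lev i.
have levS i j : i <= j -> lev i `<=` lev j.
  by move=> /ale aij _ [k ka <-]; exists k => //=; apply: leq_trans aij.
have Bb i j : b (a i) <= j < a i.+1 -> B i (V j).
  move=> /andP[bj ja]; split; first by exists j.
  move=> [k /= ka Vkj].
  have h1 := leq_bigmax (F := fun k : 'I_(a i) => N (V k)) (Ordinal ka).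
  have h2 := NP (V k) j (esym Vkj).
  have := leq_trans h2 (leq_trans h1 (leq_addl (a i) _)).
  by rewrite leqNgt; apply/negP/negPn.
have Bd i j A : B i A -> B j A -> i = j.
  move=> [Ai Ni] [Aj Nj]; have [ij|ji|//] := ltngtP i j.
    by case: Nj; apply: levS Ai.
  by case: Ni; apply: levS Aj.
exists (range B); split.
- split.
  + apply/seteqP; split=> A.
      by move=> [_ [i _ <-] [[j _ <-] _]]; exists j.
    move=> [j _ <-].
    have ex : exists i, `[< lev i (V j) >].
      by exists j.+1; apply/asboolP; exists j => //=; exact: age.
    case: (ex_minnP ex) => -[|i] /asboolP h hmin; first by case: h.
    exists (B i); first by exists i.
    split=> //= h'; have := hmin i; rewrite asboolT// ltnn => /(_ isT).
    by [].
  + move=> _ _ [i _ <-] [j _ <-] [A [Ai Aj]].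
    by rewrite (Bd _ _ _ Ai Aj).
  + move=> _ [i _ <-]; exists (V (b (a i))); apply: Bb.
    by rewrite leqnn blt.
- move=> _ [i _ <-]; apply: sub_finite_set (finite_image V (finite_II (a i.+1))).
  by move=> A [[j ja <-] _]; exists j.
- move=> F /finite_seqP[s ->]; have [p _ Hp] := Vg s.
  apply: sub_finite_set (finite_image B (finite_II p)).
  move=> _ [[i _ <-] Ni]; exists i => //=; rewrite ltnNge; apply/negP => pi.
  apply: Ni.
  have [|j /andP[bj jg] sV] := Hp (b (a i)).
    by rewrite /= (leq_trans pi)// (leq_trans (age i))// ltnW.
  exists (V j); last by [].
  by apply: Bb; rewrite bj/= (leq_trans jg)// leqW// leq_addl.
Qed.

(** Selections may repeat a set infinitely often, which would spoil the
    partition.  To prevent this, enumerate the countable union of all the covers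
    and choose a point outside each set; requiring the n-th selected set to
    contain the first n + 1 points excludes the first n + 1 sets. *)
Lemma selects_S1 (X : topologicalType) :
  (forall U : nat -> set (set X), (forall n, open_omega_cover (U n)) ->
     selects U setT) ->
  S1_Omega_Omega_gp X.
Proof.
move=> sel U OU.
have cU : countable (\bigcup_n U n).
  by apply: bigcup_countable => // n _; have [] := OU n.
have [e eP] := countable_enum cU.
have [] := OU 0 => -[_ UT /(_ set0 (finite_set0 _))[A0 UA0 _]] _.
have [x0 _] : exists x : X, ~ A0 x by apply: not_fullP => h; rewrite -h in UT.
have /choice[y yP] : forall n, exists y : X,
    oapp (fun A : set X => A <> setT -> ~ A y) True (e n).
  move=> n; case: (e n) => [A|/=]; last by exists x0.
  have [->|/not_fullP[z Az]] := pselect (A = setT).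
    by exists x0 => h; case: (h erefl).
  by exists z.
pose G n := [set` [seq y i | i <- iota 0 n.+1]].
have [n|V [g [UV Vg]]] := sel (fun n => [set A | U n A /\ G n `<=` A]).
  have [[oU UTn Ucov] _] := OU n.
  split=> [A [/oU//]|[/UTn//]|F fF].
  have [|A UA] := Ucov (F `|` G n).
    by rewrite finite_setU; split=> //; exact: finite_seq.
  by rewrite subUset => -[FA GA]; exists A.
exists V; split=> [n|]; first by have [] := UV n.
have VT n : V n <> setT.
  by have [h _] := UV n; have [[_ + _] _] := OU n => + e'; rewrite -e'.
apply: (@Omega_gp_groups _ _ g) => //.
- by move=> n; have [h _] := UV n; have [[+ _ _] _] := OU n; apply.
- move=> A; have [[n VnA]|h] := pselect (exists n, V n = A); last first.
    by exists 0 => n ?; case: h; exists n.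
  have [k ek] : exists n, e n = Some A.
    by apply: eP; exists n => //; rewrite -VnA; have [] := UV n.
  exists k => m VmA; rewrite leqNgt; apply/negP => km.
  have := yP k; rewrite ek/=; apply; first by rewrite -VnA.
  rewrite -VmA; have [_] := UV m; apply => /=.
  by apply: map_f; rewrite mem_iota/= add0n leqW.
- by move=> s; apply: Vg.
Qed.

(** * Orders of type omega_1 and chains of functions *)

Lemma sval_inj T (P : T -> Prop) : injective (@sval T P).
Proof. by move=> x y; apply: eq_sig_hprop => ? ? ?; exact: Prop_irrelevance. Qed.

Lemma uncountable_neq0 T : ~ countable [set: T] -> [set: T] !=set0.
Proof. by move=> ucT; apply/set0P/eqP => T0; apply: ucT; rewrite T0; exact: countable0. Qed.

Lemma countable_preinj T U (f : T -> U) (A : set T) (B : set U) :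
  injective f -> (forall x, A x -> B (f x)) -> countable B -> countable A.
Proof.
move=> finj AB /countable_injP[h hinj]; apply/countable_injP; exists (h \o f).
move=> x y /set_mem Ax /set_mem Ay /hinj; rewrite !inE.
by move=> /(_ (AB _ Ax) (AB _ Ay))/finj.
Qed.

Lemma countable_sig T (D : set T) : countable [set: {x | D x}] -> countable D.
Proof.
move=> /countable_injP[h hinj]; apply/countable_injP.
have /choice[k kP] : forall x : T, exists n : nat,
    forall Dx : D x, n = h (exist _ x Dx).
  move=> x; have [Dx|nDx] := pselect (D x); last by exists 0.
  by exists (h (exist _ x Dx)) => Dx'; rewrite (Prop_irrelevance Dx Dx').
exists k => x y /set_mem Dx /set_mem Dy.
rewrite (kP _ Dx) (kP _ Dy) => /hinj; rewrite !inE => /(_ I I) e.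
exact: (congr1 sval e).
Qed.

Definition omega1_order (O : Type) (lt : O -> O -> Prop) :=
  [/\ ~ countable [set: O], well_founded lt,
      forall x y z, lt x y -> lt y z -> lt x z,
      forall x y, [\/ lt x y, x = y | lt y x] &
      forall x, countable [set y | lt y x]].

(** In a well-order of X, the points with countably many predecessors form an
    initial segment D.  It is uncountable: otherwise the least point outside D
    would have all its predecessors in D, so it would belong to D. *)
Lemma uncountable_omega1 (X : Type) : ~ countable [set: X] ->
  exists (O : Type) (lt : O -> O -> Prop) (f : O -> X),
    injective f /\ omega1_order lt.
Proof.
move=> ucX; have [R Rwo] := well_ordering_principle {classic X}.
have wo (A : set X) : A !=set0 ->
    exists! z, A z /\ forall x, A x -> R z x.
  move=> [x Ax]; have [|z [[zA zmin] zu]] := Rwo (fun x => `[< A x >]).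
    by exists x; exact: asboolT.
  exists z; split.
    by split=> [|y Ay]; [exact: asboolW|apply: zmin; exact: asboolT].
  move=> t [At tmin]; apply: zu; split; first exact: asboolT.
  by move=> y Ay; apply: tmin; exact: asboolW.
have mini (A : set X) : A !=set0 -> exists2 z, A z & forall x, A x -> R z x.
  by move=> /wo[z [[Az zmin] _]]; exists z.
have Rtot (x y : X) : R x y \/ R y x.
  have [|z [->|->] zmin] := mini [set x; y]; first by exists x; left.
  - by left; apply: zmin; right.
  - by right; apply: zmin; left.
have Ranti (x y : X) : R x y -> R y x -> x = y.
  move=> xy yx; have [|z [_ zu]] := wo [set x; y]; first by exists x; left.
  have Rxx u : R u u by case: (Rtot u u).
  rewrite -[LHS]zu; last by split; [left|move=> u [->|->]].
  by apply: zu; split; [right|move=> u [->|->]].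
pose lt (x y : X) := ~ R y x.
have ltW x y : lt x y -> R x y by case: (Rtot x y).
have ltt x y z : lt x y -> lt y z -> lt x z.
  move=> xy yz zx.
  have [|t [[->|->]|->] tmin] := mini [set x; y; z]; first by exists x; left; left.
  - by apply: yz; rewrite (Ranti z x)//; [exact: ltW|apply: tmin; right].
  - by apply: xy; apply: tmin; left; left.
  - by apply: yz; apply: tmin; left; right.
have lttot x y : [\/ lt x y, x = y | lt y x].
  have [yx|] := pselect (R y x); last by constructor 1.
  have [xy|] := pselect (R x y); last by constructor 3.
  by constructor 2; apply: Ranti.
have ltwf : well_founded lt.
  move=> x; apply: contrapT => nx.
  have [|z nz zmin] := mini [set x | ~ Acc lt x]; first by exists x.
  by apply: nz; constructor => y yz; apply: contrapT => /zmin.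
pose D := [set y : X | countable [set z | lt z y]].
have ucD : ~ countable D.
  move=> cD; have [DT|] := pselect (D = setT); first by rewrite DT in cD.
  move=> /not_fullP nD.
  have [a na amin] := mini [set y | ~ D y] nD.
  apply: na; apply: sub_countable cD; apply: subset_card_le => y /= ya.
  by apply: contrapT => /amin.
exists {y | D y}, (fun x y => lt (sval x) (sval y)), sval; split.
  exact: sval_inj.
have svi : injective (sval : {y | D y} -> X) by exact: sval_inj.
split.
- by move=> /countable_sig.
- move=> o; have := ltwf (sval o); move E: (sval o) => x acc.
  elim: acc o E => {}x _ IH o E; constructor=> o' h.
  by apply: (IH (sval o')); rewrite -?E.
- by move=> x y z; exact: ltt.
- move=> x y; have [h|/svi h|h] := lttot (sval x) (sval y).
  + by constructor 1.
  + by constructor 2.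
  + by constructor 3.
- move=> [x Dx] /=; apply: (countable_preinj svi) Dx => y; exact.
Qed.

Lemma mono_bound (h : nat -> nat) :
  exists2 k : nat -> nat, {homo k : m n / m < n} & forall n, h n <= k n.
Proof.
exists (fun n => \sum_(i < n.+1) (h i).+1).
  apply: homo_ltn; first exact: ltn_trans.
  by move=> n; rewrite [ltnRHS]big_ord_recr/= addnS ltnS leq_addr.
by move=> n; rewrite big_ord_recr/= addnS leqW// leq_addl.
Qed.

(** Well-founded recursion: at z there are only countably many functions to
    dominate. *)
Lemma dominating_chain O (lt : O -> O -> Prop) (f : O -> nat -> nat) :
  well_founded lt -> (forall x, countable [set y | lt y x]) ->
  exists g : O -> nat -> nat,
    [/\ forall z, {homo g z : m n / m < n}, forall z, eventually_le (f z) (g z) &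
     forall w z, lt w z -> eventually_le (succn \o g w) (g z)].
Proof.
move=> ltwf ltc.
have step z (r : forall w, lt w z -> nat -> nat) : exists h : nat -> nat,
    [/\ {homo h : m n / m < n}, eventually_le (f z) h &
     forall w (p : lt w z), eventually_le (succn \o r w p) h].
  have [|h hP] := @countable_eventually_le {w | lt w z} setT
    (fun w => succn \o r (sval w) (proj2_sig w)).
    by apply: (countable_preinj (@sval_inj _ _)) (ltc z) => x _; exact: svalP.
  have [k kmono kP] := mono_bound (fun n => maxn (f z n) (h n)).
  exists k; split=> // [|w p].
    by exists 0 => // n _ /=; apply: leq_trans (kP n); rewrite leq_maxl.
  apply: (@eventually_le_trans h); first exact: (hP (exist _ w p) I).
  by exists 0 => // n _ /=; apply: leq_trans (kP n); rewrite leq_maxr.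
pose g := Fix ltwf (fun _ => nat -> nat) (fun z r => sval (cid (step z r))).
have gE z : g z = sval (cid (step z (fun w _ => g w))).
  rewrite /g Fix_eq// => x r s rs; congr (sval (cid (step _ _))).
  by apply: functional_extensionality_dep => w; apply/funext => p; exact: rs.
exists g; split=> [z|z|w z wz].
- by rewrite gE; case: cid => h [].
- by rewrite gE; case: cid => h [].
- by rewrite [g z]gE; case: cid => h [_ _] /= /(_ w wz).
Qed.

(** * Construction of metric spaces *)

Section Metrization.
Variables (R : realType) (T : Type) (d : T -> T -> R).
Hypotheses (dxx : forall x, d x x = 0%R) (d0 : forall x y, d x y = 0%R -> x = y)
  (dC : forall x y, d x y = d y x)
  (dD : forall y x z, (d x z <= d x y + d y z)%R).

(** A copy of T that is free to carry the structures below even when T has a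
    canonical structure of its own. *)
Definition metrized : Type := T.
HB.instance Definition _ := gen_eqMixin metrized.
HB.instance Definition _ := gen_choiceMixin metrized.
HB.instance Definition _ := @isMetric.Build R metrized d dxx d0 dC dD.

Lemma metrization : exists (X : metricType R) (f : X -> T),
  bijective f /\ forall x y, mdist x y = d (f x) (f y).
Proof. by exists (metrized : metricType R), id; split=> //; exists id. Qed.

End Metrization.

Section Metric.
Variable R : realType.
Local Open Scope ring_scope.

Lemma open_mdistP (X : metricType R) (A : set X) :
  open A <-> forall x, A x -> exists2 e, 0 < e & forall y, mdist x y < e -> A y.
Proof.
rewrite openE; split=> h x /h.
  by rewrite /interior -nbhs_ballE => -[e e0]; rewrite ballEmdist => eA; exists e.
move=> [e e0 eA]; rewrite /interior -nbhs_ballE; exists e => //.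
by rewrite ballEmdist.
Qed.

Lemma pullback_metric (X : metricType R) (T : Type) (i : T -> X) : injective i ->
  exists (Y : metricType R) (f : Y -> T),
    bijective f /\ forall x y, mdist x y = mdist (i (f x)) (i (f y)).
Proof.
move=> inj; apply: (@metrization R T (fun x y => mdist (i x) (i y))).
- by move=> x; rewrite mdistxx.
- by move=> x y /mdist_positivity/inj.
- by move=> x y; rewrite metric_sym.
- by move=> y x z; exact: metric_triangle.
Qed.

(** The inverse of one plus the first place of disagreement. *)
Definition cantor_dist (x y : nat -> bool) : R :=
  if pselect (exists n, x n != y n) is left h then (ex_minn h).+1%:R^-1 else 0.

Lemma invS_ltE m n : (m.+1%:R^-1 < n.+1%:R^-1 :> R) = (n < m)%N.
Proof. by rewrite ltf_pV2 ?posrE ?ltr0n// ltr_nat ltnS. Qed.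

Lemma invS_gt0 n : 0 < n.+1%:R^-1 :> R.
Proof. by rewrite invr_gt0 ltr0n. Qed.

Lemma cantor_dist_lt x y n :
  cantor_dist x y < n.+1%:R^-1 <-> forall i, (i <= n)%N -> x i = y i.
Proof.
rewrite /cantor_dist; case: pselect => [h|h]; last first.
  rewrite invS_gt0; split=> // _ i _; apply/eqP; apply: contrapT => /negP ?.
  by apply: h; exists i.
rewrite invS_ltE; case: ex_minnP => m xy mmin; split=> [nm i ni|eq].
  apply/eqP; apply: contrapT => /negP /mmin; rewrite leqNgt => /negP; apply.
  exact: leq_ltn_trans nm.
by rewrite ltnNge; apply: contra xy => /eq ->.
Qed.

Lemma cantor_metric (T : Type) (c : T -> nat -> bool) : injective c ->
  exists (X : metricType R) (f : X -> T), bijective f /\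
    forall n (x y : X), mdist x y < n.+1%:R^-1 <->
      forall i, (i <= n)%N -> c (f x) i = c (f y) i.
Proof.
move=> inj; have Dge0 u v : 0 <= cantor_dist u v.
  by rewrite /cantor_dist; case: pselect => // h; exact: ltW (invS_gt0 _).
have Dfar u v : cantor_dist u v = 0 \/ exists n, cantor_dist u v = n.+1%:R^-1.
  rewrite /cantor_dist; case: pselect => h; last by left.
  by right; exists (ex_minn h).
have D0 u v : cantor_dist u v = 0 -> u = v.
  move=> e; apply/funext => n.
  have /cantor_dist_lt : cantor_dist u v < n.+1%:R^-1 by rewrite e invS_gt0.
  by apply.
have [|||y x z|X [f [fb fd]]] :=
    @metrization R T (fun x y => cantor_dist (c x) (c y)); last first.
  by exists X, f; split=> // n x y; rewrite fd; exact: cantor_dist_lt.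
- have [->|[n e]] := Dfar (c x) (c z); first by rewrite addr_ge0.
  have [xy|xy] := ltP (cantor_dist (c x) (c y)) n.+1%:R^-1; last first.
    by rewrite e (le_trans xy)// lerDl.
  have [yz|yz] := ltP (cantor_dist (c y) (c z)) n.+1%:R^-1; last first.
    by rewrite e (le_trans yz)// lerDr.
  suff : cantor_dist (c x) (c z) < n.+1%:R^-1 by rewrite e ltxx.
  apply/cantor_dist_lt => i ni.
  by move/cantor_dist_lt: xy => ->//; move/cantor_dist_lt: yz => ->.
- have Dle u v : cantor_dist u v <= cantor_dist v u.
    have [->|[n e]] := Dfar u v; first exact: Dge0.
    rewrite leNgt; apply/negP; rewrite e => /cantor_dist_lt h.
    have : cantor_dist u v < n.+1%:R^-1.
      by apply/cantor_dist_lt => i /h.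
    by rewrite e ltxx.
  by move=> x y; apply/eqP; rewrite eq_le !Dle.
- by move=> x y /D0/inj.
- move=> x; have [//|[n e]] := Dfar (c x) (c x).
  have : cantor_dist (c x) (c x) < n.+1%:R^-1 by apply/cantor_dist_lt.
  by rewrite e ltxx.
Qed.

End Metric.

(** * Strong measure zero spaces with bounded families *)

Section BoundedCase.
Variable R : realType.
Local Open Scope ring_scope.

Lemma finite_lower_bound (e : nat -> R) N : (forall n, 0 < e n) ->
  exists2 d, 0 < d & forall i, (i <= N)%N -> d <= e i.
Proof.
move=> e0; elim: N => [|N [d d0 dP]].
  by exists (e 0%N) => // i; rewrite leqn0 => /eqP->.
exists (Order.min d (e N.+1)); first by rewrite lt_min d0 e0.
move=> i; rewrite leq_eqVlt => /orP[/eqP->|]; first by rewrite ge_min lexx orbT.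
by move/dP => h; rewrite ge_min h.
Qed.

Lemma mdist_lt_diam (X : metricType R) (A : set X) e :
  (diam A < e%:E)%E -> forall x y, A x -> A y -> mdist x y < e.
Proof.
rewrite /diam gt_max => /andP[_ h] x y Ax Ay; rewrite -lte_fin.
by apply: le_lt_trans h; apply: ereal_sup_ubound; exists x, y.
Qed.

Definition guesses S (small : R -> set S -> Prop) (D : S -> Prop) :=
  forall eps : nat -> R, (forall n, 0 < eps n) -> exists W : nat -> set S,
    (forall n, small (eps n) (W n)) /\ forall s, D s -> exists n, W n s.

(** Guess with the precisions of each class of indices separately: the class
    with first coordinate p provides a guess at an index not below p. *)
Lemma guesses_io S (small : R -> set S -> Prop) (D : S -> Prop) :
  guesses small D ->
  forall eps : nat -> R, (forall n, 0 < eps n) -> exists W : nat -> set S,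
    (forall n, small (eps n) (W n)) /\
    forall s, D s -> forall p, exists2 n, (p <= n)%N & W n s.
Proof.
move=> gS eps eps0.
have /choice[W WP] := fun c => gS (fun i => eps (pairn c i)) (fun i => eps0 _).
exists (fun n => W (unpairn n).1 (unpairn n).2); split=> [n|s Ds p].
  by have [/(_ (unpairn n).2) + _] := WP (unpairn n).1; rewrite unpairnK.
have [_ /(_ s Ds)[i Wi]] := WP p.
by exists (pairn p i); rewrite ?pairnK// leq_pairnl.
Qed.

(** The form of strong measure zero that passes to pullbacks of the metric
    without computing diameters. *)
Definition small_guesses (X : metricType R) :=
  guesses (fun e (I : set X) => forall x y, I x -> I y -> mdist x y < e)
    (fun=> True).

Lemma smz_small_guesses (X : metricType R) :
  strong_measure_zero X -> small_guesses X.
Proof.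
move=> smzX eps eps0; have [I [cI dI]] := smzX eps eps0; exists I.
split=> [n|x _]; first exact: mdist_lt_diam.
have [n _ Inx] : cover setT I x by rewrite cI.
by exists n.
Qed.

Section Tuples.
Variable X : metricType R.

(** Tuples of different lengths are not close. *)
Definition close e (s t : seq X) := all2 (fun x y => mdist x y < e) s t.

Lemma close_le e e' s t : e <= e' -> close e s t -> close e' s t.
Proof.
move=> ee'; elim: s t => [|x s IH] [|y t] //= /andP[xy /IH ->].
by rewrite (lt_le_trans xy).
Qed.

Lemma open_close (A : set X) s : open A -> (forall x, x \in s -> A x) ->
  exists N, forall t, close N.+1%:R^-1 s t -> forall y, y \in t -> A y.
Proof.
move=> /open_mdistP oA; elim: s => [|x s IH] sA; first by exists 0%N => -[].
have [|N NP] := IH; first by move=> y ys; apply: sA; rewrite inE ys orbT.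
have [e e0 eP] := oA x (sA _ (mem_head _ _)).
exists (maxn N (Num.trunc e^-1)) => -[//|y t] /= /andP[xy st] z.
rewrite inE => /orP[/eqP->|]; last first.
  apply: NP; apply: close_le st.
  by rewrite lef_pV2 ?posrE ?ltr0n// ler_nat ltnS leq_maxl.
apply: eP; apply: lt_trans xy _; rewrite invf_plt ?posrE ?ltr0n//.
apply: lt_le_trans (truncnS_gt _) _.
by rewrite ler_nat ltnS leq_maxr.
Qed.

Definition near_tuples e (W : set (seq X)) := forall s t, W s -> W t -> close e s t.

Hypothesis smzX : small_guesses X.
Hypothesis bounded : forall f : seq X -> nat -> nat,
  exists h, forall s, eventually_le (f s) h.

(** For the step, let the tuples of length k be guessed in each row n of
    indices.  Boundedness gives a finite part g n of row n that contains a
    correct guess, for every tuple and almost every n.  Only then choose the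
    guesses I n for one more point, as precise as the best precision required in
    that finite part; each point is in I n for infinitely many n. *)
Lemma guess_tuples k : guesses near_tuples (fun s : seq X => size s = k).
Proof.
elim: k => [|k IH] eps eps0.
  exists (fun=> [set [::]]); split=> [n s t -> ->//|s /= /size0nil ->].
  by exists 0%N.
have /choice[W WP] := fun n => IH (fun i => eps (pairn n i)) (fun i => eps0 _).
have /choice[f fP] : forall s : seq X, exists fs : nat -> nat,
    size s = k -> forall n, W n (fs n) s.
  move=> s; have [sk|nk] := pselect (size s = k); last by exists id.
  by have /choice[fs fsP] := fun n => (WP n).2 s sk; exists fs.
have [g gP] := bounded f.
have /choice[del delP] : forall n, exists d, 0 < d /\
    forall i, (i <= g n)%N -> d <= eps (pairn n i).
  move=> n; have [|d d0 dP] := @finite_lower_bound (fun i => eps (pairn n i)) (g n).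
    by move=> i; exact: eps0.
  by exists d.
have [I [Ismall Iio]] := guesses_io smzX (fun n => (delP n).1).
exists (fun m => [set s | exists x t, [/\ s = x :: t, I (unpairn m).1 x,
  ((unpairn m).2 <= g (unpairn m).1)%N & W (unpairn m).1 (unpairn m).2 t]]); split=> [m|].
  move=> _ _ [x [s [-> Ix le Ws]]] [y [t [-> Iy _ Wt]]] /=.
  rewrite /close /=; apply/andP; split.
    apply: lt_le_trans (Ismall _ _ _ Ix Iy) _.
    by apply: le_trans ((delP _).2 _ le) _; rewrite unpairnK.
  by have := (WP (unpairn m).1).1 (unpairn m).2 _ _ Ws Wt; rewrite unpairnK.
case=> [//|x s] [sk]; have [N _ NP] := gP s.
have [n Nn Ix] := Iio x Logic.I N.
exists (pairn n (f s n)), x, s; rewrite pairnK; split=> //=.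
  exact: NP.
exact: fP.
Qed.

(** Boundedness is used twice: to find, before guessing, a precision at which
    a guess of s decides a member of the n-th cover containing s, and to find,
    after guessing, windows that contain a correct guess. *)
Lemma selects_tuples k U : (forall n, open_omega_cover (U n)) ->
  selects U (fun s : seq X => size s = k).
Proof.
move=> Ucov.
have /choice[f fP] : forall s : seq X, exists fs : nat -> nat,
    forall n, exists2 A, U n A &
      forall t, close (fs n).+1%:R^-1 s t -> forall y, y \in t -> A y.
  move=> s; have /choice[fs fsP] : forall n, exists N, exists2 A, U n A &
      forall t, close N.+1%:R^-1 s t -> forall y, y \in t -> A y.
    move=> n; have [A UA sA] := omega_cover_seq s (Ucov n).
    have [|N NP] := open_close _ sA; first by have [+ _ _] := Ucov n; apply.
    by exists N, A.
  by exists fs.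
have [g gP] := bounded f.
have [W [Wsmall Wio]] := guesses_io (@guess_tuples k) (fun n => invS_gt0 R (g n)).
have /choice[f' f'P] : forall s : seq X, exists fs : nat -> nat,
    size s = k -> forall p, (p <= fs p)%N /\ W (fs p) s.
  move=> s; have [sk|nk] := pselect (size s = k); last by exists id.
  have /choice[fs fsP] : forall p, exists n, (p <= n)%N /\ W n s.
    by move=> p; have [n] := Wio s sk p; exists n.
  by exists fs.
have [g' g'P] := bounded (fun s p => (f' s p).+1).
have /choice[V VP] : forall n, exists A, U n A /\
    ((exists2 B, U n B & forall t, W n t -> forall y, y \in t -> B y) ->
     forall t, W n t -> forall y, y \in t -> A y).
  move=> n; have [[B UB WB]|h] := pselect (exists2 B, U n B & forall t, W n t ->
      forall y, y \in t -> B y); first by exists B.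
  by have [A UA _] := omega_cover_seq [::] (Ucov n); exists A.
exists V, g'; split=> [n|s sk]; first by have [] := VP n.
have [N _ NP] := gP s; have [N' _ N'P] := g'P s.
exists (maxn N N') => // p /=; rewrite geq_max => /andP[Np N'p].
have [pf Wf] := f'P s sk p.
exists (f' s p); first by rewrite pf; exact: N'P.
have [_ VP'] := VP (f' s p); apply: VP' => //.
have [A UA AP] := fP s (f' s p); exists A => // t Wt y; apply: AP.
apply: close_le (Wsmall _ _ _ Wf Wt).
by rewrite lef_pV2 ?posrE ?ltr0n// ler_nat ltnS; apply: NP; exact: leq_trans pf.
Qed.

Lemma bounded_smz_S1 : S1_Omega_Omega_gp X.
Proof.
apply: selects_S1 => U Ucov.
apply: (@selects_sub _ _ _ (\bigcup_c (fun s : seq X => size s = c))).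
  by move=> s _; exists (size s).
by apply: selects_bigcup => c; apply: selects_tuples.
Qed.

End Tuples.
End BoundedCase.

(** * The space of an unbounded chain *)

Lemma near_all_seq (T : eqType) (P : T -> nat -> Prop) (s : seq T) :
  (forall x, x \in s -> \forall i \near \oo, P x i) ->
  \forall i \near \oo, forall x, x \in s -> P x i.
Proof.
elim: s => [|x s IH] sP; first by exists 0.
have [N _ NP] := sP x (mem_head _ _).
have [|N' _ N'P] := IH; first by move=> y ys; apply: sP; rewrite inE ys orbT.
exists (maxn N N') => // i /=; rewrite geq_max => /andP[Ni N'i] y.
by rewrite inE => /orP[/eqP->|]; [exact: NP|exact: N'P].
Qed.

Section Scale.
Variables (R : realType) (O : Type) (lt : O -> O -> Prop) (g : O -> nat -> nat).
Hypotheses (ltO : omega1_order lt) (gmono : forall z, {homo g z : m n / m < n})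
  (glt : forall w z, lt w z -> eventually_le (succn \o g w) (g z))
  (gunb : forall h, exists z, ~ eventually_le (g z) h).

Definition indic_range (f : nat -> nat) (n : nat) : bool := `[< exists i, f i = n >].

Variables (X : metricType R) (c : X -> nat -> bool).
Hypotheses (cinj : injective c)
  (cdist : forall n (x y : X), (mdist x y < n.+1%:R^-1)%R <->
     forall i, i <= n -> c x i = c y i)
  (cX : forall x, (exists z, c x = indic_range (g z)) \/
     \forall n \near \oo, c x n = false)
  (cfin : forall u : nat -> bool, (\forall n \near \oo, u n = false) ->
     exists x, c x = u).

Lemma open_agree (A : set X) x : open A -> A x ->
  exists N, forall y, (forall i, i <= N -> c x i = c y i) -> A y.
Proof.
move=> oA Ax; have [|N NP] := @open_close _ _ A [:: x] oA.
  by move=> y; rewrite inE => /eqP->.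
by exists N => y /cdist xy; apply: (NP [:: y]); rewrite ?inE// /close/= andbT.
Qed.

(** The subsets of {0, ..., n-1} are finitely many points, so they lie, with
    the points of G, in one open member A of U; a set that omits [n, m) agrees
    below m with one of them, which suffices for m large. *)
Lemma omega_cover_gap (U : set (set X)) (G : seq X) n : open_omega_cover U ->
  exists m A, [/\ n < m, U A, forall x, x \in G -> A x &
    forall x, (forall i, n <= i < m -> c x i = false) -> A x].
Proof.
move=> Ucov.
have /choice[q qP] : forall s : n.-tuple bool, exists x, c x = nth false s.
  move=> s; apply: cfin; exists n => // i /= ni.
  by rewrite nth_default// size_tuple.
have [A UA GA] := omega_cover_seq (G ++ [seq q s | s : n.-tuple bool]) Ucov.
have [oU _ _] := Ucov.
have /choice[N NP] : forall s : n.-tuple bool, exists N,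
    forall y, (forall i, i <= N -> c (q s) i = c y i) -> A y.
  move=> s; apply: open_agree (oU _ UA) (GA _ _).
  by rewrite mem_cat map_f ?orbT// mem_enum.
exists (maxn n (\max_s N s)).+1, A; split=> //; first by rewrite ltnS leq_maxl.
  by move=> x xG; apply: GA; rewrite mem_cat xG.
move=> x gap; pose s := [tuple of mkseq (c x) n].
apply: (NP s) => i iN; rewrite qP /=; have [ni|ni] := ltnP i n.
  by rewrite nth_mkseq.
rewrite nth_default ?size_mkseq// gap// ni/= ltnS.
by rewrite (leq_trans iN)// leq_max leq_bigmax orbT.
Qed.

(** The elements of x in [a, b) lie among the first i values of some function:
    the form of having at most i elements that the pigeonhole argument uses. *)
Definition sparse i a b (x : X) :=
  exists e : nat -> nat, forall l, a <= l < b -> c x l -> exists2 r, r < i & l = e r.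

(** With consecutive gaps [v j, v j.+1), the block i consists of the i * i + 1
    gaps from i on, and h i is its right end.  If g z exceeds h at i, then so
    does g w for almost all such i when w is not below z, so the range of g w has
    at most i elements below h i.  At most i sets of this kind cannot meet all
    the gaps of the block, and a finite set misses all late blocks.  The indices i with h i < g z i depend only on z,
    which yields windows common to all finite sets. *)
Lemma selects_tail (U : nat -> set (set X)) (G : seq X) :
  (forall n, open_omega_cover (U n)) ->
  exists C : set X, countable C /\
    selects U (fun s => forall x, x \in s -> x \in G \/ ~ C x).
Proof.
move=> Ucov.
have /choice[m /choice[A mA]] : forall nj : nat * nat, exists m A, [/\ nj.1 < m, U nj.2 A,
    forall x, x \in G -> A x &
    forall x, (forall i, nj.1 <= i < m -> c x i = false) -> A x].
  by move=> [n j]; apply: omega_cover_gap.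
pose v := fix v j := if j is i.+1 then m (v i, i) else 0.
have vS j : v j < v j.+1 by case: (mA (v j, j)).
have vlt : {homo v : i j / i < j} by apply: homo_ltn => //; exact: ltn_trans.
have vle : {homo v : i j / i <= j} by move=> i j; exact: ltnW_homo.
have idv i : i <= v i by elim: i => // i IH; exact: leq_ltn_trans (vS i).
pose V j := A (v j, j).
have VU j : U j (V j) by case: (mA (v j, j)).
have VG j x : x \in G -> V j x by case: (mA (v j, j)) => _ _ + _; apply.
have Vgap j x : ~ V j x -> exists2 l, v j <= l < v j.+1 & c x l.
  case: (mA (v j, j)) => _ _ _ h nV; apply: contrapT => nl; apply: nV.
  apply: h => l lj; apply/negP => cl; apply: nl; by exists l.
pose h i := v (i + i * i).+1.
(* The single z on which C and the windows depend. *)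
have [z nz] := gunb h.
have /choice[ix ixP] : forall p, exists i, p <= i /\ h i < g z i.
  move=> p; apply: contrapT => np; apply: nz; exists p => // i /= pi.
  by rewrite leqNgt; apply/negP => hi; apply: np; exists i.
have [_ _ _ tot ctb] := ltO.
pose C x := exists2 w, lt w z & c x = indic_range (g w).
have [x0 _] := cfin (nearW _ (fun n => erefl false)).
exists C; split.
  have /choice[k kP] : forall w, exists x,
      (exists y, c y = indic_range (g w)) -> c x = indic_range (g w).
    move=> w; have [[y yw]|n] := pselect (exists y, c y = indic_range (g w)).
      by exists y.
    by exists x0.
  apply: (@sub_countable _ _ _ [set w | lt w z]); last exact: ctb.
  apply: card_le_trans (card_image_le k _); apply: subset_card_le => x [w wz xw].
  by exists w => //; apply: cinj; rewrite xw kP//; exists x.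
have sp x : ~ C x -> \forall i \near \oo, h i < g z i -> sparse i (v i) (h i) x.
  move=> nC; have [[w xw]|[N _ NP]] := cX x; last first.
    exists N => // i /= Ni _; exists id => l /andP[il _].
    by rewrite NP//=; exact: leq_trans Ni (leq_trans (idv i) il).
  have [N _ NP] : eventually_le (g z) (g w).
    have [wz|->|zw] := tot w z; first by case: nC; exists w.
      by exists 0.
    apply: eventually_le_trans (glt zw); exists 0 => // n _ /=; exact: ltnW.
  exists N => // i /= Ni hi; exists (g w) => l /andP[_ lh].
  rewrite xw => /asboolP[r rl]; exists r => //.
  rewrite ltnNge; apply/negP => ir; move: lh; rewrite -rl ltnNge => /negP; apply.
  rewrite (leq_trans (ltnW hi))// (leq_trans (NP i Ni))//.
  exact: ltnW_homo (@gmono w) _ _ ir.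
exists V, (fun p => (ix p + ix p * ix p).+1); split=> // s sGC.
have sps : \forall i \near \oo, forall x, x \in s ->
    x \in G \/ (h i < g z i -> sparse i (v i) (h i) x).
  apply: near_all_seq => x /sGC[xG|/sp xs]; first by exists 0 => // i _; left.
  by apply: filterS xs => i; right.
have [N _ NP] := sps; exists (maxn N (size s)) => // p /=.
rewrite geq_max => /andP[Np sp'].
have [pi hi] := ixP p; set i := ix p in pi hi *.
have {}NP := NP i (leq_trans Np pi).
apply: contrapT => nj.
have /choice[e eP] : forall x, exists e : nat -> nat, x \in s -> x \notin G ->
    forall l, v i <= l < h i -> c x l -> exists2 r, r < i & l = e r.
  move=> x; have [xs|] := boolP (x \in s); last by exists id.
  have [xG|/(_ hi)[e eP]] := NP x xs; last by exists e.
  by exists id => _; rewrite xG.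
(* Were every gap of the block met by a point of s, the element found in a gap
   would be determined by the position of that point in s and the rank of the
   element, giving an injection of i * i + 1 gaps into size s * i pairs. *)
have /choice[rho rhoP] : forall j : 'I_(i * i).+1, exists ar : 'I_(size s) * 'I_i,
    v (i + j) <= e (nth x0 s ar.1) ar.2 < v (i + j).+1.
  move=> j; have [x xs nV] : exists2 x, x \in s & ~ V (i + j) x.
    apply: contrapT => nx; apply: nj; exists (i + j).
      by rewrite (leq_trans pi (leq_addr _ _))//= ltnS leq_add2l -ltnS.
    by move=> x xs; apply: contrapT => nV; apply: nx; exists x.
  have [l /andP[jl lj] cl] := Vgap _ _ nV.
  have xG : x \notin G by apply/negP => /(VG (i + j)).
  have [|//|r ri lr] := eP x xs xG l.
    rewrite (leq_trans (vle _ _ (leq_addr j i)) jl)/= (leq_trans lj)//.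
    by apply: vle; rewrite ltnS leq_add2l -ltnS.
  have xi : index x s < size s by rewrite index_mem.
  by exists (Ordinal xi, Ordinal ri); rewrite /= nth_index// -lr jl lj.
have rho_inj : injective rho.
  move=> j j' ejj; apply/val_inj/eqP; rewrite -(eqn_add2l i) /=.
  have /andP[] := rhoP j; have := rhoP j'; rewrite -ejj => /andP[].
  set l := e _ _ => a b a' b'; have [jj|jj|//] := ltngtP (i + j) (i + j').
    by have := leq_trans b' (leq_trans (vle _ _ jj) a); rewrite ltnn.
  by have := leq_trans b (leq_trans (vle _ _ jj) a'); rewrite ltnn.
have := leq_card rho rho_inj; rewrite card_prod !card_ord ltnNge => /negP; apply.
by rewrite leq_mul2r (leq_trans sp' pi) orbT.
Qed.

(** The covers of class 0 determine a countable set C and take care of the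
    finite sets that avoid it.  A set that contains the n-th point of C is left
    to class n.+1, where this point joins G and one point fewer remains. *)
Lemma selects_extend k (G : seq X) U : (forall n, open_omega_cover (U n)) ->
  selects U (fun s => exists2 F, size F = k & forall x, x \in s -> x \in G ++ F).
Proof.
elim: k G U => [|k IH] G U Ucov.
  have /choice[V VP] : forall n, exists A, U n A /\ forall x, x \in G -> A x.
    by move=> n; have [A] := omega_cover_seq G (Ucov n); exists A.
  exists V, succn; split=> [n|s [F /size0nil -> sG]]; first exact: (VP n).1.
  exists 0 => // p _; exists p; first by rewrite leqnn/=.
  by move=> x /sG; rewrite cats0 => /(VP p).2.
have [C [/countable_enum[e eP] tail]] := selects_tail G (fun n => Ucov (pairn 0 n)).
pose cons_e n := oapp (cons^~ G) G (e n).
pose F n : set (seq X) := if n is j.+1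
  then [set s | exists2 F, size F = k & forall x, x \in s -> x \in cons_e j ++ F]
  else [set s | forall x, x \in s -> x \in G \/ ~ C x].
apply: (@selects_sub _ _ _ (\bigcup_n F n)); last first.
  by apply: selects_bigcup => -[//|j]; apply: IH.
move=> s [t tk sGt]; have [[x [xt Cx]]|nC] := pselect (exists x, x \in t /\ C x).
  have [n en] := eP _ Cx; exists n.+1 => //; exists (rem x t).
    by rewrite size_rem// tk.
  move=> y /sGt; rewrite /cons_e en/= inE !mem_cat => /orP[->|]; first by rewrite orbT.
  by rewrite (perm_mem (perm_to_rem xt)) inE => /orP[->//|->]; rewrite !orbT.
exists 0 => //= x /sGt; rewrite mem_cat => /orP[|xt]; first by left.
by right=> Cx; apply: nC; exists x.
Qed.

Lemma scale_S1 : S1_Omega_Omega_gp X.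
Proof.
apply: selects_S1 => U Ucov.
pose F k (s : seq X) := exists2 F, size F = k & forall x, x \in s -> x \in [::] ++ F.
apply: (@selects_sub _ _ _ (\bigcup_k F k)); last first.
  by apply: selects_bigcup => k; apply: selects_extend.
by move=> s _; exists (size s) => //; exists s.
Qed.

End Scale.

(** * From strong measure zero to the selection property *)

Lemma countableU1 T (A : set T) x : countable A -> countable (x |` A).
Proof.
move=> cA; apply: (@sub_countable _ _ _
  (\bigcup_(b in [set: bool]) (if b then [set x] else A))).
  apply: subset_card_le => y [->|Ay]; first by exists true.
  by exists false.
by apply: bigcup_countable => // -[] _; [exact: countable1|].
Qed.

Lemma countable_seqs T (A : set T) : countable A ->
  countable [set s : seq T | forall i x0, i < size s -> A (nth x0 s i)].
Proof.
move=> /countable_injP[h hinj]; apply/countable_injP.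
exists (fun s => pickle (map h s)) => s t /set_mem sA /set_mem tA /(pcan_inj pickleK).
elim: s t sA tA => [|x s IH] [|y t] //= sA tA [xy st].
congr cons; first by apply: hinj xy; rewrite inE; [exact: (sA 0 x)|exact: (tA 0 x)].
by apply: IH => // i x0 il; [exact: (sA i.+1 x0)|exact: (tA i.+1 x0)].
Qed.

Section Omega1.
Variables (O : Type) (lt : O -> O -> Prop).
Hypothesis ltO : omega1_order lt.

(** A finite sequence lies in the initial segment closed at its largest term,
    and such a segment has only countably many finite sequences: a bound for
    them is a function indexed by O. *)
Lemma bounded_seqs (Y : eqType) (f : Y -> O) : injective f ->
  (forall F : O -> nat -> nat, exists h, forall z, eventually_le (F z) h) ->
  forall F : seq Y -> nat -> nat, exists h, forall s, eventually_le (F s) h.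
Proof.
move=> finj bdd F; have [ucO _ ltt tot ctb] := ltO.
have [z0 _] := uncountable_neq0 ucO.
have /choice[F' F'P] : forall z, exists h, forall s,
    (forall i x0, i < size s -> f (nth x0 s i) = z \/ lt (f (nth x0 s i)) z) ->
    eventually_le (F s) h.
  move=> z; apply: (@countable_eventually_le _ [set s | forall i x0, i < size s ->
    f (nth x0 s i) = z \/ lt (f (nth x0 s i)) z]).
  apply: (@countable_seqs _ [set y | f y = z \/ lt (f y) z]).
  apply: (countable_preinj finj) (countableU1 z (ctb z)) => x [->|]; first by left.
  by right.
have [h hP] := bdd F'; exists h => s.
suff [z zs] : exists z, forall x, x \in s -> f x = z \/ lt (f x) z.
  by apply: (eventually_le_trans _ (hP z)); apply: F'P => i x0 si; exact/zs/mem_nth.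
elim: s => [|x s [z zs]]; first by exists z0.
have [xz|xz|zx] := tot (f x) z.
- by exists z => y; rewrite inE => /orP[/eqP->|/zs//]; right.
- by exists z => y; rewrite inE => /orP[/eqP->|/zs//]; left.
- exists (f x) => y; rewrite inE => /orP[/eqP->|/zs[->|yz]]; first by left.
    by right.
  by right; apply: ltt yz zx.
Qed.

(** A strictly increasing function enumerates its range. *)
Lemma indic_range_inj (f f' : nat -> nat) :
  {homo f : m n / m < n} -> {homo f' : m n / m < n} ->
  indic_range f = indic_range f' -> f = f'.
Proof.
have le : forall f f' : nat -> nat, {homo f : m n / m < n} ->
    {homo f' : m n / m < n} -> indic_range f = indic_range f' -> forall n, f' n <= f n.
  move=> {}f {}f' fm f'm ff' n.
  have /choice[r rP] : forall n, exists m, f' m = f n.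
    move=> m; have : indic_range f (f m) by apply/asboolP; exists m.
    by rewrite ff' => /asboolP.
  have f'le := ltnW_homo f'm.
  suff nr : n <= r n by rewrite -rP f'le.
  elim: n => // n IH; apply: leq_ltn_trans IH _; rewrite ltnNge; apply/negP => h.
  by have := f'le _ _ h; rewrite !rP leqNgt fm.
move=> fm f'm ff'; apply/funext => n; apply/eqP.
by rewrite eqn_leq !le.
Qed.

Lemma chain_indic_range_inj (g : O -> nat -> nat) :
  (forall z, {homo g z : m n / m < n}) ->
  (forall w z, lt w z -> eventually_le (succn \o g w) (g z)) ->
  injective (fun z => indic_range (g z)).
Proof.
move=> gm glt w z /(indic_range_inj (@gm w) (@gm z)) e; have [_ _ _ tot _] := ltO.
have nlt a b : g a = g b -> ~ lt a b.
  by move=> ab /glt[N _ /(_ N (leqnn N))]; rewrite /= ab ltnn.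
have [h|//|h] := tot w z; first by case: (nlt w z).
by case: (nlt z w).
Qed.

End Omega1.

Section Main.
Variable R : realType.

Lemma uncountable_smz_S1 (X : metricType R) :
  strong_measure_zero X -> ~ countable [set: X] ->
  exists Y : metricType R, S1_Omega_Omega_gp Y /\ ~ countable [set: Y].
Proof.
move=> smzX ucX; have [O [lt [i [iinj ltO]]]] := uncountable_omega1 ucX.
have [ucO ltwf ltt tot ctb] := ltO.
have ucb (Y T : Type) (f : Y -> T) (h : O -> T) : bijective f -> injective h ->
    ~ countable [set: Y].
  move=> [f' fK f'K] hinj cY; apply: ucO.
  by apply: (countable_preinj (inj_comp (can_inj f'K) hinj)) cY.
have [bdd|/existsNP[f fP]] := pselect (forall f : O -> nat -> nat,
    exists h, forall z, eventually_le (f z) h).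
  have [Y [p [pb pd]]] := pullback_metric iinj; exists Y; split; last exact: (ucb _ _ p id).
  apply: bounded_smz_S1; last exact: (bounded_seqs ltO (bij_inj pb)).
  move=> eps /(smz_small_guesses smzX)[I [Ismall Icov]].
  exists (fun n => (i \o p) @^-1` I n); split=> [n x y Ix Iy|x _].
    by rewrite pd; exact: Ismall.
  by have [//|n] := Icov (i (p x)); exists n.
have [g [gmono fg glt]] := dominating_chain f ltwf ctb.
have gunb h : exists z, ~ eventually_le (g z) h.
  apply: contrapT => nz; apply: fP; exists h => z; apply: eventually_le_trans (fg z) _.
  by apply: contrapT => ?; apply: nz; exists z.
pose P (u : nat -> bool) := (exists z, u = indic_range (g z)) \/
  \forall n \near \oo, u n = false.
have [Y [p [pb pd]]] := cantor_metric R (@sval_inj _ P).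
exists Y; split.
  apply: (scale_S1 ltO gmono glt gunb (c := sval \o p)) => //.
  - exact: inj_comp (@sval_inj _ _) (bij_inj pb).
  - by move=> x; exact: svalP (p x).
  - move=> u uf; have [p' _ p'K] := pb.
    by exists (p' (exist P u (or_intror uf))); rewrite /= p'K.
have gP z : P (indic_range (g z)) by left; exists z.
apply: (ucb _ _ p (fun z => exist P _ (gP z)) pb) => w z /(congr1 sval) /=.
exact: (chain_indic_range_inj ltO).
Qed.
End Main.

(** * From the selection property to strong measure zero *)

(** The principle S1(Omega, O).  It passes from one space to another more
    easily than S1(Omega, Omega^gp), there being no partition to carry along. *)
Definition S1_Omega_O (X : topologicalType) := forall U : nat -> set (set X),
  (forall n, @Omega X (U n)) ->
  exists V, (forall n, U n (V n)) /\ forall x, exists n, V n x.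

Lemma S1_Omega_O_of_gp (X : topologicalType) : S1_Omega_Omega_gp X -> S1_Omega_O X.
Proof.
move=> S U /S[V [UV [[_ _ cov] _]]]; exists V; split=> // x.
by have [_ [n _ <-] xV] := cov _ (finite_set1 x); exists n; exact: xV.
Qed.

Section Converse.
Variable R : realType.

Lemma open_mball (X : metricType R) (x : X) (e : R) : open [set y | (mdist x y < e)%R].
Proof.
apply/open_mdistP => y /= xy; exists (e - mdist x y)%R; first by rewrite subr_gt0.
move=> z yz; apply: le_lt_trans (metric_triangle x y z) _.
by rewrite -ltrBrDl.
Qed.

Lemma diam_lt (X : metricType R) (A : set X) (d e : R) : (0 < e)%R -> (d < e)%R ->
  (forall x y, A x -> A y -> (mdist x y <= d)%R) -> (diam A < e%:E)%E.
Proof.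
move=> e0 de Ad; rewrite /diam gt_max lte_fin e0/=.
apply: (@le_lt_trans _ _ d%:E); last by rewrite lte_fin.
by apply: ge_ereal_sup => _ [x [y [Ax Ay ->]]]; rewrite lee_fin Ad.
Qed.

Definition separable_metric (X : metricType R) := forall e : R, (0 < e)%R ->
  exists q : nat -> X, forall x, exists n, (mdist (q n) x < e)%R.

(** The sets of the n-th cover are the finite unions whose i-th term is a ball
    of the size prescribed for the index coded by (n, i).  The number of terms is
    arbitrary, which makes it an omega-cover, while the terms selected for
    different n have different indices.  If X itself is such a union, it has the
    required cover already. *)
Lemma S1_smz (X : metricType R) : S1_Omega_O X -> separable_metric X ->
  strong_measure_zero X.
Proof.
move=> S sepX eps eps0.
have quarter_gt0 n : (0 < eps n / 2 / 2)%R by rewrite !divr_gt0.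
have /choice[q qP] := fun n => sepX _ (quarter_gt0 n).
pose O m k := [set x | (mdist (q m k) x < eps m / 2 / 2)%R].
pose union n s := [set x | exists2 i, i < size s & O (pairn n i) (nth 0 s i) x].
have smz_of_choices (s : nat -> seq nat) : (forall x, exists n, union n (s n) x) ->
    exists I : nat -> set X,
      cover [set: nat] I = [set: X] /\ (forall n : nat, diam (I n) < (eps n)%:E)%E.
  move=> scov.
  exists (fun m => [set x | (unpairn m).2 < size (s (unpairn m).1) /\
    O m (nth 0 (s (unpairn m).1) (unpairn m).2) x]); split.
    apply/seteqP; split=> // x _; have [n [i il Ox]] := scov x.
    by exists (pairn n i) => //=; rewrite pairnK.
  move=> n; apply: (@diam_lt _ _ (eps n / 2)) => //.
    by rewrite ltr_pdivrMr// ltr_pMr// ltr1n.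
  move=> x y [_ Ox] [_ Oy].
  rewrite [leRHS]splitr.
  apply: le_trans (metric_triangle x (q n (nth 0 (s (unpairn n).1) (unpairn n).2)) y) _.
  by apply/ltW/ltrD => //; rewrite metric_sym.
have [[n [s sT]]|nT] := pselect (exists n s, union n s = setT).
  apply: (smz_of_choices (fun m => if m == n then s else [::])) => x.
  by exists n; rewrite eqxx sT.
have [n|V [UV Vcov]] := S (fun n => range (union n)).
  split.
    split.
    - move=> _ [s _ <-].
      have -> : union n s = \bigcup_(i in [set i | i < size s]) O (pairn n i) (nth 0 s i).
        by [].
      by apply: bigcup_open => i _; exact: open_mball.
    - by move=> [s _ sT]; apply: nT; exists n, s.
    - move=> F /finite_seqP[t ->].
      have /choice[k kP] : forall x, exists k : nat -> nat,
          forall i, O (pairn n i) (k i) x.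
        by move=> x; have /choice[k kP] := fun i => qP (pairn n i) x; exists k.
      exists (union n (mkseq (fun i => k (nth (q 0 0) t i) i) (size t))).
        by exists (mkseq (fun i => k (nth (q 0 0) t i) i) (size t)).
      move=> x /= xt; exists (index x t); first by rewrite size_mkseq index_mem.
      by rewrite nth_mkseq ?index_mem// nth_index//; exact: kP.
  by apply: (@sub_countable _ _ _ [set: seq nat]) => //; exact: card_image_le.
have /choice[s sP] : forall n, exists s, V n = union n s.
  by move=> n; have [s _ <-] := UV n; exists s.
by apply: (smz_of_choices s) => x; have [n] := Vcov x; rewrite sP; exists n.
Qed.

(** The image of j being uniformly separated, all its subsets are closed, so
    any set A of Y gives the open set of the points of X that are not the image
    of a point outside A. *)
Lemma S1_closed_discrete (X Y : metricType R) (j : Y -> X) (e : R) : (0 < e)%R ->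
  (forall x y, x <> y -> (e <= mdist (j x) (j y))%R) ->
  S1_Omega_O X -> S1_Omega_O Y.
Proof.
move=> e0 jsep S U UO.
have jinj : injective j.
  move=> x y xy; apply: contrapT => /jsep; rewrite xy mdistxx.
  by rewrite leNgt e0.
pose Phi (A : set Y) := [set x | forall y, j y = x -> A y].
have PhiK A : j @^-1` Phi A = A.
  by apply/seteqP; split=> y; [exact|move=> Ay z /jinj ->].
have oPhi A : open (Phi A).
  apply/open_mdistP => x Ax.
  have e2 : (0 < e / 2)%R by rewrite divr_gt0.
  have one y y' : (mdist x (j y) < e / 2)%R -> (mdist x (j y') < e / 2)%R -> y = y'.
    move=> xy xy'; apply: contrapT => /jsep; rewrite leNgt => /negP; apply.
    apply: le_lt_trans (metric_triangle _ x _) _.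
    by rewrite (splitr e) ltrD// metric_sym.
  have [[y [xy ny]]|h] := pselect (exists y, (mdist x (j y) < e / 2)%R /\ ~ A y).
    exists (mdist x (j y)).
      rewrite mdist_gt0; apply/eqP => xe; apply: ny; exact/Ax/esym.
    move=> z + y' jy'; rewrite -jy'.
    have [->|] := pselect (y' = y); first by rewrite ltxx.
    by move=> yy' lt1; case: yy'; apply: one => //; exact: lt_trans xy.
  exists (e / 2)%R => // z + y jy; rewrite -jy => xy; apply: contrapT => nA; apply: h.
  by exists y.
have [n|V [UV Vcov]] := S (fun n => Phi @` U n).
  have [[_ UT Ucov] cU] := UO n; split.
    split.
    - by move=> _ [A _ <-]; exact: oPhi.
    - move=> [A UA /(congr1 (preimage j))]; rewrite PhiK preimage_setT => AT.
      by rewrite AT in UA.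
    - move=> F /(@finite_preimage _ _ F j) fF.
      have [|A UA FA] := Ucov (j @^-1` F); first by apply: fF => ? ? _ _; exact: jinj.
      by exists (Phi A); [exists A|move=> x Fx y yx; apply: FA; rewrite /preimage/= yx].
  by apply: sub_countable cU; exact: card_image_le.
exists (fun n => j @^-1` V n); split=> [n|y]; last by have [n] := Vcov (j y); exists n.
by have [A UA <-] := UV n; rewrite PhiK.
Qed.

(** If X has no countable e-net, then a maximal e-separated set, being an
    e-net, is uncountable. *)
Lemma uncountable_separated (X : metricType R) : [set: X] !=set0 ->
  ~ separable_metric X ->
  exists2 e : R, (0 < e)%R & exists D : set X, ~ countable D /\
    forall x y, D x -> D y -> x <> y -> (e <= mdist x y)%R.
Proof.
move=> [x0 _] /existsNP[e /not_implyP[e0 nq]]; exists e => //.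
pose P (D : set X) := forall x y, D x -> D y -> x <> y -> (e <= mdist x y)%R.
have [F FP Ftot|D [PD Dmax]] := @Zorn_bigcup X P.
  move=> x y [A FA Ax] [B FB By]; have [AB|BA] := Ftot _ _ FA FB.
    by apply: (FP _ FB) => //; exact: AB.
  by apply: (FP _ FA) => //; exact: BA.
exists D; split=> // /countable_enum[d dP]; apply: nq.
exists (fun n => odflt x0 (d n)) => x.
suff [y Dy xy] : exists2 y, D y & (mdist y x < e)%R.
  by have [n dn] := dP _ Dy; exists n; rewrite dn.
apply: contrapT => nD.
have far y : D y -> (e <= mdist y x)%R.
  by move=> Dy; rewrite leNgt; apply/negP => yx; apply: nD; exists y.
apply: (Dmax (x |` D)).
  rewrite properEneq; split; last by move=> ?; right.
  apply/eqP => DD; have := far x; rewrite mdistxx leNgt e0 => /(_ _)/negP; apply=> //.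
  by rewrite DD; left.
move=> y z [->|Dy] [->|Dz] // yz; [rewrite metric_sym|..]; first exact: far.
  exact: far.
exact: PD.
Qed.

(** In the nonseparable case the Cantor metric comes from the ranges of the
    functions of a chain of length omega_1, which are distinct. *)
Lemma uncountable_S1_smz (X : metricType R) :
  S1_Omega_Omega_gp X -> ~ countable [set: X] ->
  exists Y : metricType R, strong_measure_zero Y /\ ~ countable [set: Y].
Proof.
move=> /S1_Omega_O_of_gp SX ucX.
have [sepX|nsepX] := pselect (separable_metric X).
  by exists X; split=> //; exact: S1_smz.
have [e e0 [D [ucD Dsep]]] := uncountable_separated (uncountable_neq0 ucX) nsepX.
have [O [lt [i [iinj ltO]]]] := uncountable_omega1 (contra_not (@countable_sig _ D) ucD).
have [ucO ltwf ltt tot ctb] := ltO.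
have [g [gmono _ glt]] := dominating_chain (fun _ => id) ltwf ctb.
have [Y [p [pb pd]]] := cantor_metric R (chain_indic_range_inj ltO gmono glt).
have ucY : ~ countable [set: Y].
  move=> cY; apply: ucO; have [p' pK p'K] := pb.
  exact: (countable_preinj (can_inj p'K)) cY.
exists Y; split=> //; apply: S1_smz.
  apply: (@S1_closed_discrete X Y (fun y => sval (i (p y))) e) => // x y xy.
  apply: Dsep; try exact: svalP.
  by move=> /sval_inj /iinj /(bij_inj pb).
move=> d d0; have [y0 _] := uncountable_neq0 ucY.
pose N := Num.trunc d^-1.
have Nd : (N.+1%:R^-1 < d)%R.
  by rewrite invf_plt ?posrE ?ltr0n// truncnS_gt.
have /choice[r rP] : forall s : N.+1.-tuple bool, exists y,
    (exists x, forall k, k <= N -> indic_range (g (p x)) k = nth false s k) ->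
    forall k, k <= N -> indic_range (g (p y)) k = nth false s k.
  move=> s; have [[x xs]|h] := pselect (exists x, forall k, k <= N ->
    indic_range (g (p x)) k = nth false s k); first by exists x.
  by exists y0.
exists (nth y0 [seq r s | s : N.+1.-tuple bool]) => x.
pose s := [tuple of mkseq (indic_range (g (p x))) N.+1].
have rs : r s \in [seq r s | s : N.+1.-tuple bool] by rewrite map_f// mem_enum.
exists (index (r s) [seq r s | s : N.+1.-tuple bool]); rewrite nth_index//.
apply: lt_trans Nd; apply/pd => k kN.
by rewrite rP//; [|exists x => l lN]; rewrite nth_mkseq.
Qed.

End Converse.

Theorem theorem4p2 (R : realType) :
  ((forall X : metricType R, S1_Omega_Omega_gp X -> countable [set: X]) ->
   (forall X : metricType R, strong_measure_zero X -> countable [set: X]))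
  /\
  ((forall X : metricType R, S1_Omega_Omega_gp X -> countable [set: X]) <->
   (forall X : metricType R, strong_measure_zero X -> countable [set: X])).
Proof.
have S1_smz : (forall X : metricType R, S1_Omega_Omega_gp X -> countable [set: X]) ->
    forall X : metricType R, strong_measure_zero X -> countable [set: X].
  move=> S1c X smzX; apply: contrapT => /(uncountable_smz_S1 smzX)[Y [SY]].
  by apply; exact: S1c.
split=> //; split=> // smzc X SX; apply: contrapT => /(uncountable_S1_smz SX)[Y [smzY]].
by apply; exact: smzc.
Qed.
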